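(* Fix $0<\alpha<1$ and a $1$-labelled finite simple graph $H$, and define $$\mathcal{D}=\mathcal{D}_{H,\alpha}:=\big\{W\in\mathcal{W}_{[0,1]}:\mu_L(\{y\in[0,1]:t_y(H,W)=\alpha\})=0\big\}.$$ Let $(W_n)_{n\ge1}\subset\mathcal{D}$ be such that $W_n\to W_0\in\mathcal{W}_{[0,1]}$ in cut-norm, with $W_0\in\mathcal{D}$. Let $S=\{1,2\}$ and let $c_n:[0,1]\to S$ be defined for $n\ge0$ by $$c_n(y):=\begin{cases}1,&\text{if }t_y(H,W_n)<\alpha,\\2,&\text{if }t_y(H,W_n)\ge\alpha.\end{cases}$$ Then the sequence $(W_n,c_n)$ converges to $(W_0,c_0)$ in $\mathcal{W}_S$, i.e. $\|(W_n,c_n)-(W_0,c_0)\|_\Box^S\to0$.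
   Context: A graphon is a symmetric measurable function $W:[0,1]^2\to[0,1]$; $\mathcal{W}_{[0,1]}$ is the set of graphons; $\mu_L$ is Lebesgue measure. The cut-norm is $\|U\|_\Box:=\sup_{A,B\subset[0,1]}\left|\int_{A\times B}U\,dx\,dy\right|$ over Lebesgue measurable $A,B$, and $W_n\to W_0$ in cut-norm means $\|W_n-W_0\|_\Box\to0$. A $1$-labelled graph $H$ is a graph with one distinguished vertex, labelled $1$. For a graphon $W$ and $x_1\in[0,1]$, $$t_{x_1}(H,W)=\int_{[0,1]^{V(H)\setminus\{1\}}}\prod_{\{u,v\}\in E(H)}W(x_u,x_v)\prod_{v\in V(H)\setminus\{1\}}dx_v.$$ For a finite set $S$, $\mathcal{W}_S$ is the set of pairs $(W,c)$ with $W$ a graphon and $c:[0,1]\to S$ measurable, and $$\|(W,c)-(W',c')\|_\Box^S:=\|W-W'\|_\Box+\sum_{s\in S}\mu_L\big(c^{-1}(s)\,\Delta\,c'^{-1}(s)\big).$$ *)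

(* Defs.v *)
From HB Require Import structures.
From mathcomp Require Import all_boot all_order all_algebra finmap.
From mathcomp Require Import all_classical all_reals all_analysis.

Set Implicit Arguments.
Unset Strict Implicit.
Unset Printing Implicit Defensive.
Import Order.TTheory GRing.Theory Num.Theory.
Import numFieldNormedType.Exports.
Local Open Scope classical_set_scope.
Local Open Scope ring_scope.


Definition tuple_cons (R : realType) (n : nat)
    (p : measurableTypeR R * n.-tuple (measurableTypeR R)) :
    n.+1.-tuple (measurableTypeR R) :=
  [tuple of p.1 :: p.2].

Lemma measurable_tuple_cons (R : realType) (n : nat) :
  measurable_fun [set: measurableTypeR R * n.-tuple (measurableTypeR R)]
    (@tuple_cons R n).
Proof. exact: measurable_cons. Qed.

Section lebesgue_cons.
Variables (R : realType) (n : nat).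
Variable m : {sigma_finite_measure set (n.-tuple (measurableTypeR R)) -> \bar R}.
Local Open Scope ereal_scope.

Definition lebesgue_cons :=
  pushforward ((@lebesgue_measure R) \x m) (@tuple_cons R n).

Let lebesgue_cons0 : lebesgue_cons set0 = 0.
Proof. by rewrite /lebesgue_cons /pushforward preimage_set0 measure0. Qed.

Let lebesgue_cons_ge0 A : 0 <= lebesgue_cons A.
Proof. by rewrite /lebesgue_cons /pushforward; exact: measure_ge0. Qed.

Let lebesgue_cons_semi_sigma_additive : semi_sigma_additive lebesgue_cons.
Proof.
have mc A : measurable A -> measurable (@tuple_cons R n @^-1` A).
  by move=> mA; rewrite -[X in measurable X]setTI; exact: measurable_tuple_cons.
move=> F mF tF mUF; rewrite /lebesgue_cons /pushforward preimage_bigcup.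
apply: measure_semi_sigma_additive.
- by move=> k; exact: mc.
- apply/trivIsetP => /= i j _ _ ij; rewrite -preimage_setI.
  by move/trivIsetP : tF => /(_ _ _ _ _ ij) ->//; rewrite preimage_set0.
- by rewrite -preimage_bigcup; exact: mc.
Qed.

HB.instance Definition _ := isMeasure.Build _ _ _ lebesgue_cons
  lebesgue_cons0 lebesgue_cons_ge0 lebesgue_cons_semi_sigma_additive.

Let lebesgue_cons_sigma_finite : sigma_finite setT lebesgue_cons.
Proof.
have /sigma_finiteP[F [FT ndF Foo]] := sigma_finiteT (@lebesgue_measure R).
have /sigma_finiteP[G [GT ndG Goo]] := sigma_finiteT m.
pose g (t : n.+1.-tuple (measurableTypeR R)) := (thead t, [tuple of behead t]).
have mg : measurable_fun setT g.
  apply/measurable_fun_pairP; split; first exact: measurable_tnth.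
  exact: measurable_behead.
have gK p : g (tuple_cons p) = p.
  by case: p => a t; rewrite /g /tuple_cons; congr (_, _); exact/val_inj.
exists (fun k => g @^-1` (F k `*` G k)).
  rewrite -preimage_bigcup; suff -> : \bigcup_k (F k `*` G k) = setT by [].
  rewrite -setXTT FT GT predeqE => -[x y]; split.
    by move=> [k _ []/= ? ?]; split; exists k.
  move=> [/= [k _ Fkx] [l _ Gly]]; exists (maxn k l) => //; split.
  - by move: x Fkx; exact/subsetPset/ndF/leq_maxl.
  - by move: y Gly; exact/subsetPset/ndG/leq_maxr.
move=> k; have [mFk Fk] := Foo k; have [mGk Gk] := Goo k; split.
  by rewrite -[X in measurable X]setTI; apply: mg => //; exact: measurableX.
rewrite /lebesgue_cons /pushforward -comp_preimage.
rewrite (_ : g \o _ = id); last by apply/funext => p /=; rewrite gK.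
by rewrite preimage_id product_measure1E// lte_mul_pinfty// ge0_fin_numE.
Qed.

HB.instance Definition _ :=
  Measure_isSigmaFinite.Build _ _ _ lebesgue_cons lebesgue_cons_sigma_finite.

End lebesgue_cons.

(** Lebesgue measure on the Borel sets of R^n; [lebesgue_measure] is the Borel
    version in dimension 1. *)
Fixpoint borel_lebesgue (R : realType) (n : nat) :
    {sigma_finite_measure set (n.-tuple (measurableTypeR R)) -> \bar R} :=
  match n with
  | 0 => [the {sigma_finite_measure set _ -> \bar R} of
           dirac ([tuple] : 0.-tuple (measurableTypeR R))]
  | k.+1 => [the {sigma_finite_measure set _ -> \bar R} of
              lebesgue_cons (borel_lebesgue R k)]
  end.

(** Completions: the measurable sets below are the Lebesgue measurable (not
    only the Borel) sets, in dimensions 1, 2 and n. *)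
Notation lebesgue1 R := (@completed_lebesgue_measure R).
Notation lebesgue1_type R := (caratheodory_type ((@wlength R idfun)^*)%mu).

Notation lebesgue2 R := (@completed_measure_extension _ _ R
  ((@lebesgue_measure R) \x (@lebesgue_measure R))%E).
Notation lebesgue2_type R := (caratheodory_type
  (((@lebesgue_measure R) \x (@lebesgue_measure R))%E^*)%mu).

Notation lebesguen R n :=
  (@completed_measure_extension _ _ R (borel_lebesgue R n)).

Definition unit_itv (R : realType) : set R := `[0, 1].

Definition unit_cube (R : realType) (n : nat) : set (n.-tuple R) :=
  [set x | forall i, unit_itv (tnth x i)].

(** A graphon is a function on [0,1]^2; it is represented by a function on the
    plane whose values outside [0,1]^2 are irrelevant everywhere below. *)
Record is_graphon (R : realType) (W : R * R -> R) : Prop := IsGraphon {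
  graphon_measurable :
    @measurable_fun _ _ (lebesgue2_type R) (measurableTypeR R)
      (@unit_itv R `*` @unit_itv R) W;
  graphon_sym : forall x y : R, unit_itv x -> unit_itv y -> W (x, y) = W (y, x);
  graphon_itv : forall x y : R, unit_itv x -> unit_itv y ->
    0 <= W (x, y) <= 1 }.

Definition cutnorm (R : realType) (U : R * R -> R) : \bar R :=
  ereal_sup [set r : \bar R | exists A B : set R,
    [/\ measurable (A : set (lebesgue1_type R)),
        measurable (B : set (lebesgue1_type R)),
        A `<=` @unit_itv R, B `<=` @unit_itv R &
        r = `| \int[lebesgue2 R]_(z in A `*` B) (U z)%:E |%E] ].

Record labelled_graph := LabelledGraph {
  vertex : finType;
  adj : rel vertex;
  adj_sym : symmetric adj;
  adj_irrefl : irreflexive adj;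
  label1 : vertex }.

Section density.
Variables (R : realType) (H : labelled_graph).
Local Notation unlabelled := {v : vertex H | v != label1 H}.

Definition position (y : R) (x : #|{: unlabelled}|.-tuple R)
    (v : vertex H) : R :=
  if insub v is Some u then tnth x (enum_rank (u : unlabelled)) else y.

(** The condition on ranks selects each unordered edge {u, v} exactly once;
    the chosen orientation is irrelevant since W is symmetric. The integrand is
    measurable for almost every y in [0,1] only (W is merely Lebesgue
    measurable); for the remaining y the value, given by the total integral of
    the library, is immaterial. *)
Definition labelled_density (W : R * R -> R) (y : R) : R :=
  \int[lebesguen R #|{: unlabelled}|]_(x in @unit_cube R _)
    \prod_(e : vertex H * vertex H |
           adj e.1 e.2 && (enum_rank e.1 < enum_rank e.2)%N)
      W (position y x e.1, position y x e.2).

End density.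

Definition graphon_D (R : realType) (H : labelled_graph) (alpha : R)
    (W : R * R -> R) : Prop :=
  is_graphon W /\
  lebesgue1 R [set y | unit_itv y /\ labelled_density H W y = alpha] = 0%E.

Definition coloured_graphon (R : realType) (S : finType)
    (Wc : (R * R -> R) * (R -> S)) : Prop :=
  is_graphon Wc.1 /\
  forall B : set S,
    measurable (@unit_itv R `&` Wc.2 @^-1` B : set (lebesgue1_type R)).

Definition coloured_dist (R : realType) (S : finType)
    (Wc Wc' : (R * R -> R) * (R -> S)) : \bar R :=
  (cutnorm (Wc.1 \- Wc'.1)%R +
   \sum_(s : S) lebesgue1 R ((@unit_itv R `&` Wc.2 @^-1` [set s]) `+`
                             (@unit_itv R `&` Wc'.2 @^-1` [set s])))%E.

Definition S12 : finType := seq_sub [:: 1%N; 2%N].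
Definition colour1 : S12 := SeqSub (mem_head 1%N [:: 2%N]).
Definition colour2 : S12 := SeqSub (mem_last 1%N [:: 2%N]).

Definition threshold_colour (R : realType) (H : labelled_graph) (alpha : R)
    (W : R * R -> R) (y : R) : S12 :=
  if labelled_density H W y < alpha then colour1 else colour2.

(* Main.v *)
Require Import Defs.
From HB Require Import structures.
From mathcomp Require Import all_boot all_order all_algebra finmap.
From mathcomp Require Import all_classical all_reals all_analysis.
From mathcomp Require Import measurable_realfun ring lra.
Import Order.TTheory GRing.Theory Num.Theory.
Import numFieldNormedType.Exports.
Local Open Scope classical_set_scope.
Local Open Scope ring_scope.

(** Telescope the product over the edges of [H], replacing [W n] by [W 0] one
    edge at a time. For a Borel set [A] of labels, each replacement changes the
    integral over [A] of the labelled density by at most the cut norm of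
    [W n - W 0]: once all vertices but the two ends of the edge are fixed, the
    remaining factors split as [f x * g y] with values in [0, 1], and a bilinear
    form is extremal at indicators. Hence the densities [t n], [t 0] satisfy
    [d * mu A <= #edges * ||W n - W 0||] whenever they differ by [d] with a
    constant sign on [A]; with [A] the set where [t 0 < alpha - d] and
    [alpha <= t n] (and symmetrically), the colour classes can differ only on a
    small set and on [|t 0 - alpha| <= d], whose measure vanishes with [d].
    Lebesgue measurable graphons are first replaced by Borel functions equal to
    them almost everywhere. *)

Set Implicit Arguments.
Unset Strict Implicit.

(** * Integration over the unit cube *)

Section fubini_tonelli_rectangle.
Local Open Scope ereal_scope.
Context d1 d2 (T1 : measurableType d1) (T2 : measurableType d2) (R : realType).
Variables (m1 : {sigma_finite_measure set T1 -> \bar R})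
          (m2 : {sigma_finite_measure set T2 -> \bar R}).
Variables (A : set T1) (B : set T2).
Hypotheses (mA : measurable A) (mB : measurable B).
Variable f : T1 * T2 -> \bar R.
Hypotheses (mf : measurable_fun setT f) (f0 : forall z, 0 <= f z).

Let g := f \_ (A `*` B).

Let mg : measurable_fun setT g.
Proof.
apply/(measurable_restrictT _ (measurableX mA mB)); exact: measurable_funTS.
Qed.

Let g0 z : 0 <= g z.
Proof. by rewrite /g patchE; case: ifP. Qed.

Lemma measurable_integral_snd :
  measurable_fun setT (fun x => \int[m2]_(y in B) f (x, y)).
Proof.
have mh : measurable_fun setT (f \_ (setT `*` B)).
  apply/(measurable_restrictT _ (measurableX measurableT mB)).
  exact: measurable_funTS.
have h0 z : 0 <= (f \_ (setT `*` B)) z by rewrite patchE; case: ifP.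
rewrite (_ : (fun x => _) = (fun x => \int[m2]_y (f \_ (setT `*` B)) (x, y))).
  exact: (measurable_fun_fubini_tonelli_F _ mh h0).
apply/funext => x; rewrite integral_mkcond; apply: eq_integral => y _.
by rewrite !patchE in_setX in_setT.
Qed.

(** Extending the integrand by zero outside the rectangle turns this into Tonelli on the whole
    product space; [integral_swap] is obtained in the same way. *)
Lemma integral_setX :
  \int[m1 \x m2]_(z in A `*` B) f z =
  \int[m1]_(x in A) \int[m2]_(y in B) f (x, y).
Proof.
rewrite integral_mkcond (fubini_tonelli1 g mg g0) [RHS]integral_mkcond.
apply: eq_integral => x _; rewrite /fubini_F patchE.
case: ifPn => xA; last first.
  by rewrite integral0_eq// => y _; rewrite /g patchE in_setX (negbTE xA).
rewrite [RHS]integral_mkcond; apply: eq_integral => y _.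
by rewrite /g !patchE in_setX xA.
Qed.

Lemma integral_swap :
  \int[m1]_(x in A) \int[m2]_(y in B) f (x, y) =
  \int[m2]_(y in B) \int[m1]_(x in A) f (x, y).
Proof.
rewrite -integral_setX integral_mkcond (fubini_tonelli2 g mg g0) [RHS]integral_mkcond.
apply: eq_integral => y _; rewrite /fubini_G patchE.
case: ifPn => yB; last first.
  by rewrite integral0_eq// => x _; rewrite /g patchE in_setX (negbTE yB) andbF.
rewrite [RHS]integral_mkcond; apply: eq_integral => x _.
by rewrite /g !patchE in_setX yB andbT.
Qed.

End fubini_tonelli_rectangle.

Section cube.
Local Open Scope ereal_scope.
Variable R : realType.
Local Notation mT := (measurableTypeR R).
Local Notation mu := (@lebesgue_measure R).
Local Notation I := (@unit_itv R).
Local Notation bl n := (borel_lebesgue R n).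
Local Notation cube n := (@unit_cube R n : set (n.-tuple mT)).

Lemma measurable_unit_itv : measurable (I : set mT).
Proof. exact: measurable_itv. Qed.

Lemma measurable_unit_cube n : measurable (cube n).
Proof.
rewrite (_ : cube n = \bigcap_(i in [set: 'I_n]) (fun x => tnth x i) @^-1` I).
  apply: fin_bigcap_measurable; [exact: finite_finset|move=> i _].
  rewrite -[X in measurable X]setTI.
  by apply: measurable_tnth => //; exact: measurable_unit_itv.
by apply/seteqP; split=> [x xI i _|x xI i]; [exact: xI|exact: (xI i)].
Qed.

Arguments measurable_unit_cube : clear implicits.
Arguments measurable_unit_itv : clear implicits.

Lemma lebesgue_unit_itv : mu I = 1.
Proof. by rewrite /unit_itv lebesgue_measure_itv/= lte_fin ltr01 -EFinB subr0. Qed.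

Lemma cube_cons n y (x : n.-tuple mT) :
  cube n.+1 (tuple_cons (y, x)) <-> (I `*` cube n) (y, x).
Proof.
split=> [c|[Iy cx] i].
  split; first by have := c ord0; rewrite tnth0.
  by move=> i /=; have := c (lift ord0 i); rewrite tnthS.
have [j ->|->] := unliftP ord0 i; first by rewrite tnthS; exact: cx.
by rewrite tnth0.
Qed.

(** In dimension [n.+1] the measure is the image of a product measure under [tuple_cons], and the
    cube pulls back to the product of [I] with the [n]-cube. A change of variables followed by
    Tonelli then gives the iterated integral. *)
Lemma integral_cube_cons n (F : n.+1.-tuple mT -> \bar R) :
  measurable_fun setT F -> (forall z, 0 <= F z) ->
  \int[bl n.+1]_(z in cube n.+1) F z =
  \int[mu]_(y in I) \int[bl n]_(x in cube n) F (tuple_cons (y, x)).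
Proof.
move=> mF F0.
have -> : \int[bl n.+1]_(z in cube n.+1) F z =
   \int[mu \x bl n]_(p in I `*` cube n) (F \o @tuple_cons R n) p.
  rewrite /= /lebesgue_cons ge0_integral_pushforward//.
  - congr (integral _ _ _); apply/seteqP.
    by split=> -[y x]; move/cube_cons.
  - exact: measurable_tuple_cons.
  - exact: measurable_unit_cube.
  - exact: measurable_funTS.
rewrite integral_setX//.
- exact: measurable_unit_itv.
- exact: measurable_unit_cube.
- by apply: measurableT_comp => //; exact: measurable_tuple_cons.
- by move=> z; exact: F0.
Qed.

Lemma measurable_integral_cube_cons n (F : n.+1.-tuple mT -> \bar R) :
  measurable_fun setT F -> (forall z, 0 <= F z) ->
  measurable_fun setT
    (fun y : mT => \int[bl n]_(x in cube n) F (tuple_cons (y, x))).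
Proof.
move=> mF F0.
have mFc : measurable_fun setT (F \o @tuple_cons R n).
  by apply: measurableT_comp => //; exact: measurable_tuple_cons.
exact: (measurable_integral_snd (bl n) (measurable_unit_cube n) mFc
  (fun p => F0 _)).
Qed.

Lemma integral_unit_itv_cst (r : \bar R) : \int[mu]_(y in I) r = r.
Proof.
transitivity (r * mu I); first exact: integral_cst measurable_unit_itv _.
by rewrite lebesgue_unit_itv mule1.
Qed.

Lemma borel_lebesgue_cube n : bl n (cube n) = 1.
Proof.
elim: n => [|n IHn]; first by rewrite /= diracE mem_set//; case.
transitivity (\int[bl n.+1]_(z in cube n.+1) cst 1 z).
  rewrite integral_cst; last exact: measurable_unit_cube.
  by rewrite mul1e.
rewrite integral_cube_cons//=.
transitivity (\int[mu]_(y in I) cst 1 y).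
  apply: eq_integral => y _; transitivity (1 * bl n (cube n)).
    exact: integral_cst (measurable_unit_cube n) _.
  by rewrite IHn mule1.
exact: integral_unit_itv_cst.
Qed.

Definition tuple_set n (z : n.-tuple mT) (i : 'I_n) (s : mT) : n.-tuple mT :=
  [tuple if j == i then s else tnth z j | j < n].

Lemma tnth_tuple_set n (z : n.-tuple mT) i s j :
  tnth (tuple_set z i s) j = if j == i then s else tnth z j.
Proof. by rewrite tnth_mktuple. Qed.

Lemma tuple_setC n (z : n.-tuple mT) i j s t : i != j ->
  tuple_set (tuple_set z i s) j t = tuple_set (tuple_set z j t) i s.
Proof.
move=> ij; apply: eq_from_tnth => k; rewrite !tnth_tuple_set.
by have [->|//] := eqVneq k j; rewrite eq_sym (negbTE ij).
Qed.

Lemma measurable_tuple_set n (i : 'I_n) :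
  measurable_fun setT (fun p : n.-tuple mT * mT => tuple_set p.1 i p.2).
Proof.
apply/measurable_fun_tnthP => j.
rewrite (_ : _ \o _ = fun p => if j == i then p.2 else tnth p.1 j).
  case: eqP => _; first exact: measurable_snd.
  apply: (measurableT_comp (measurable_tnth j)); exact: measurable_fst.
by apply/funext => p /=; rewrite tnth_tuple_set.
Qed.

Lemma measurable_tuple_set_val n (z : n.-tuple mT) (i : 'I_n) :
  measurable_fun setT (tuple_set z i).
Proof.
exact: (measurableT_comp (measurable_tuple_set i) (pair1_measurable z)).
Qed.

Lemma tuple_set_cons0 n y (x : n.-tuple mT) s :
  tuple_set (tuple_cons (y, x)) ord0 s = tuple_cons (s, x).
Proof.
apply: eq_from_tnth => k; rewrite tnth_tuple_set.
by have [j ->|->] := unliftP ord0 k; rewrite ?eqxx ?tnth0 ?tnthS.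
Qed.

Lemma tuple_set_consS n y (x : n.-tuple mT) i s :
  tuple_set (tuple_cons (y, x)) (lift ord0 i) s = tuple_cons (y, tuple_set x i s).
Proof.
apply: eq_from_tnth => k; rewrite tnth_tuple_set.
have [j ->|->] := unliftP ord0 k; last by rewrite !tnth0.
by rewrite !tnthS tnth_tuple_set (inj_eq lift_inj).
Qed.

Lemma measurable_resample n (i : 'I_n) (F : n.-tuple mT -> \bar R) :
  measurable_fun setT F -> (forall z, 0 <= F z) ->
  measurable_fun setT (fun z => \int[mu]_(s in I) F (tuple_set z i s)).
Proof.
move=> mF F0.
have mFs : measurable_fun setT (F \o (fun p => tuple_set p.1 i p.2)).
  by apply: measurableT_comp => //; exact: measurable_tuple_set.
exact: (measurable_integral_snd mu measurable_unit_itv mFs (fun p => F0 _)).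
Qed.

(* The coordinates are independent and uniform, so redrawing one of them does
   not change the law; this brings any two coordinates to the innermost
   integrals without permuting the factors of the product measure. *)
Lemma integral_resample n (i : 'I_n) (F : n.-tuple mT -> \bar R) :
  measurable_fun setT F -> (forall z, 0 <= F z) ->
  \int[bl n]_(z in cube n) F z =
  \int[bl n]_(z in cube n) \int[mu]_(s in I) F (tuple_set z i s).
Proof.
elim: n i F => [|n IHn] i F mF F0; first by case: i.
have mG := measurable_resample i mF F0.
rewrite (integral_cube_cons mF F0) (integral_cube_cons mG); last first.
  by move=> z; exact: integral_ge0.
have mFc : measurable_fun setT (F \o @tuple_cons R n).
  by apply: measurableT_comp => //; exact: measurable_tuple_cons.
(* A tail coordinate is redrawn by the induction hypothesis, with the head held fixed. *)
have [j ->|->] := unliftP ord0 i.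
  apply: eq_integral => y _.
  have mFy : measurable_fun setT (fun x => F (tuple_cons (y, x))).
    exact: (measurableT_comp mFc (pair1_measurable y)).
  rewrite (IHn j _ mFy (fun=> F0 _)).
  by under eq_integral do under eq_integral do rewrite /= -tuple_set_consS.
(* Once the head is redrawn nothing depends on its old value, so the outer integral over [I] is that
   of a constant and drops out. Tonelli exchanges the two integrals that remain. *)
under [RHS]eq_integral do under eq_integral do
  under eq_integral do rewrite tuple_set_cons0.
rewrite integral_unit_itv_cst.
exact: (integral_swap mu (bl n) measurable_unit_itv
  (measurable_unit_cube n) mFc (fun=> F0 _)).
Qed.

Lemma integral_resample2 n (i j : 'I_n) (F : n.-tuple mT -> \bar R) :
  measurable_fun setT F -> (forall z, 0 <= F z) ->
  \int[bl n]_(z in cube n) F z =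
  \int[bl n]_(z in cube n) \int[mu]_(t in I) \int[mu]_(s in I)
     F (tuple_set (tuple_set z j t) i s).
Proof.
move=> mF F0; rewrite (integral_resample i mF F0).
rewrite (integral_resample j (measurable_resample i mF F0))//.
by move=> z; exact: integral_ge0.
Qed.

End cube.

Arguments measurable_unit_itv : clear implicits.
Arguments measurable_unit_cube : clear implicits.

(** This class is closed under products, measurable substitutions and partial integration over sets
    of measure at most 1. All integrals below are therefore finite, and real-valued integrals can be
    manipulated without integrability side conditions beyond it. *)
Definition mfun01 d (T : measurableType d) (R : realType) (f : T -> R) :=
  measurable_fun setT f /\ forall x, 0 <= f x <= 1.

Section mfun01.
Context d (T : measurableType d) (R : realType).
Implicit Types f g : T -> R.

Lemma mfun01_ge0 f x : mfun01 f -> (0 <= (f x)%:E)%E.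
Proof. by case=> _ /(_ x)/andP[]. Qed.

Lemma mfun01_mul f g : mfun01 f -> mfun01 g -> mfun01 (fun x => f x * g x).
Proof.
move=> [mf f01] [mg g01]; split; first exact: measurable_funM.
by move=> x; have /andP[? ?] := f01 x; have /andP[? ?] := g01 x;
  rewrite mulr_ge0//= mulr_ile1.
Qed.

Lemma mfun01_cst (r : R) : 0 <= r <= 1 -> mfun01 (fun _ : T => r).
Proof. by split. Qed.

Lemma mfun01_prod (I : Type) (s : seq I) (f : I -> T -> R) :
  (forall i, mfun01 (f i)) -> mfun01 (fun x => \prod_(i <- s) f i x).
Proof.
move=> f01; elim: s => [|i s IHs].
  under eq_fun do rewrite big_nil; by apply: mfun01_cst; rewrite ler01 lexx.
under eq_fun do rewrite big_cons; exact: mfun01_mul.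
Qed.

Lemma mfun01_indic (A : set T) : measurable A -> mfun01 (\1_A : T -> R).
Proof.
move=> mA; split; first exact: measurable_indic.
by move=> x; rewrite indicE; case: (x \in A); rewrite ?lexx ?ler01.
Qed.

Lemma mfun01_comp d' (S : measurableType d') (h : S -> T) f :
  measurable_fun setT h -> mfun01 f -> mfun01 (fun x => f (h x)).
Proof. by move=> mh [mf f01]; split=> //; exact: measurableT_comp. Qed.

Context (m : {measure set T -> \bar R}) (A : set T).
Hypotheses (mA : measurable A) (mA1 : (m A <= 1)%E).

Lemma mfun01_integrable f : mfun01 f -> m.-integrable A (EFin \o f).
Proof.
move=> [mf f01]; apply: measurable_bounded_integrable => //.
- exact: le_lt_trans mA1 (ltry _).
- exact: measurable_funTS.
- exists 1; split=> // M M1 x _ /=; have /andP[f0 f1] := f01 x.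
  by rewrite ger0_norm// (le_trans f1)// ltW.
Qed.

Lemma EFin_Rintegral f : mfun01 f ->
  (\int[m]_(x in A) f x)%:E = (\int[m]_(x in A) (f x)%:E)%E.
Proof.
by move=> f01; rewrite fineK//; apply: integrable_fin_num => //;
  exact: mfun01_integrable.
Qed.

Lemma Rintegral01 f : mfun01 f -> 0 <= \int[m]_(x in A) f x <= 1.
Proof.
move=> f01; rewrite Rintegral_ge0/=; last by move=> x _; case: f01 => _ /(_ x)/andP[].
rewrite -lee_fin EFin_Rintegral//.
apply: (@le_trans _ _ (\int[m]_(x in A) cst 1%:E x)%E).
  apply: ge0_le_integral => //.
  - by move=> x _; exact: mfun01_ge0.
  - by apply/measurable_EFinP; apply: measurable_funTS; case: f01.
  - by move=> x _; rewrite lee_fin; case: f01 => _ /(_ x)/andP[].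
by rewrite integral_cst// mul1e.
Qed.

End mfun01.

Section mfun01_fubini.
Context d1 d2 (T1 : measurableType d1) (T2 : measurableType d2) (R : realType).
Variables (m1 : {sigma_finite_measure set T1 -> \bar R})
          (m2 : {sigma_finite_measure set T2 -> \bar R}).
Variables (A : set T1) (B : set T2).
Hypotheses (mA : measurable A) (mB : measurable B).
Hypotheses (mA1 : (m1 A <= 1)%E) (mB1 : (m2 B <= 1)%E).
Variable F : T1 * T2 -> R.
Hypothesis F01 : mfun01 F.

Lemma mfun01_pair1 x : mfun01 (fun y => F (x, y)).
Proof. by apply: mfun01_comp F01; exact: pair1_measurable. Qed.

Lemma mfun01_pair2 y : mfun01 (fun x => F (x, y)).
Proof. by apply: mfun01_comp F01; exact: pair2_measurable. Qed.

Lemma mfun01_Rintegral : mfun01 (fun x => \int[m2]_(y in B) F (x, y)).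
Proof.
split; last by move=> x; apply: Rintegral01 => //; exact: mfun01_pair1.
apply/measurable_EFinP; rewrite (_ : _ \o _ =
    fun x => (\int[m2]_(y in B) (EFin \o F) (x, y))%E).
  apply: measurable_integral_snd => //; last by move=> z; exact: mfun01_ge0.
  by apply/measurable_EFinP; case: F01.
by apply/funext => x /=; rewrite EFin_Rintegral//; exact: mfun01_pair1.
Qed.

Lemma mfun01_Rintegral_swap :
  \int[m1]_(x in A) \int[m2]_(y in B) F (x, y) =
  \int[m2]_(y in B) \int[m1]_(x in A) F (x, y).
Proof.
congr fine.
transitivity (\int[m1]_(x in A) \int[m2]_(y in B) (EFin \o F) (x, y))%E.
  by apply: eq_integral => x _; rewrite EFin_Rintegral//; exact: mfun01_pair1.
rewrite integral_swap//; last 2 first.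
- by apply/measurable_EFinP; case: F01.
- by move=> z; exact: mfun01_ge0.
by apply: eq_integral => y _; rewrite EFin_Rintegral//; exact: mfun01_pair2.
Qed.

Lemma mfun01_Rintegral_setX :
  \int[m1]_(x in A) \int[m2]_(y in B) F (x, y) =
  fine (\int[m1 \x m2]_(z in A `*` B) (F z)%:E)%E.
Proof.
congr fine.
transitivity (\int[m1]_(x in A) \int[m2]_(y in B) (EFin \o F) (x, y))%E.
  by apply: eq_integral => x _; rewrite EFin_Rintegral//; exact: mfun01_pair1.
rewrite -integral_setX//.
- by apply/measurable_EFinP; case: F01.
- by move=> z; exact: mfun01_ge0.
Qed.

End mfun01_fubini.

(** * Bilinear forms and the cut norm *)

Section bang_bang.
Variable R : realType.
Local Notation mT := (measurableTypeR R).
Local Notation mu := (@lebesgue_measure R).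
Local Notation I := (@unit_itv R).

Lemma lebesgue_unit_itv_le1 (A : set mT) : measurable A -> A `<=` I -> (mu A <= 1)%E.
Proof.
move=> mA AI; rewrite -(lebesgue_unit_itv R); apply: le_measure => //; rewrite inE//.
exact: measurable_unit_itv.
Qed.

(** Since [f] lies in [0, 1], the integral of [f * (g - h)] can only grow when [f] is replaced by
    the indicator of the set where [h <= g]. Stating this with sums instead of differences keeps
    every integrand in [mfun01]. *)
Lemma bang_bang1 (f g h : mT -> R) : mfun01 f -> mfun01 g -> mfun01 h ->
  exists A : set mT, [/\ measurable A, A `<=` I &
    \int[mu]_(x in I) (f x * g x) + \int[mu]_(x in A) h x <=
    \int[mu]_(x in I) (f x * h x) + \int[mu]_(x in A) g x].
Proof.
move=> f01 g01 h01; pose P := [set x | h x <= g x].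
have mP : measurable P.
  rewrite -[P]setTI; apply: measurable_fun_le => //; by [case: g01|case: h01].
have mI := measurable_unit_itv R.
exists (I `&` P); split; [exact: measurableI|by move=> x []|].
have ii (k : mT -> R) : mfun01 k -> mu.-integrable I (EFin \o k).
  by apply: mfun01_integrable => //; exact: lebesgue_unit_itv_le1.
have PE (k : mT -> R) : mfun01 k ->
    \int[mu]_(x in I `&` P) k x = \int[mu]_(x in I) (\1_P x * k x).
  move=> _; rewrite Rintegral_mkcondr; apply: eq_Rintegral => x _.
  by rewrite patchE indicE; case: (x \in P); rewrite ?mul1r ?mul0r.
rewrite !PE// -!RintegralD//;
  try by apply: ii; apply: mfun01_mul => //; exact: mfun01_indic.
have iD (k l : mT -> R) : mfun01 k -> mfun01 l ->
    mu.-integrable I (EFin \o (fun x => f x * k x + \1_P x * l x)).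
  move=> k01 l01; rewrite (_ : EFin \o _ =
    (EFin \o (fun x => f x * k x)%R) \+ (EFin \o (fun x => \1_P x * l x)%R))%E//.
  by apply: integrableD => //; apply: ii; apply: mfun01_mul => //;
    exact: mfun01_indic.
apply: le_Rintegral => //; try exact: iD.
move=> x _; rewrite indicE; have [_ /(_ x)/andP[f0 f1]] := f01.
have [xP|] := boolP (x \in P).
  by move: xP; rewrite inE /P /=; nra.
by rewrite notin_setE /P /= => /negP; rewrite -ltNge => gh; nra.
Qed.

(** The form with kernel [U - V] is linear in [f] for fixed [g], so it is at most its value at some
    indicator of [A]; with [A] fixed it is linear in [g], so an indicator of [B] does at least as
    well. On the resulting rectangle the hypothesis applies. *)
Lemma bang_bang2 (f g : mT -> R) (U V : mT * mT -> R) (delta : R) :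
  mfun01 f -> mfun01 g -> mfun01 U -> mfun01 V ->
  (forall A B : set mT, measurable A -> measurable B -> A `<=` I -> B `<=` I ->
    \int[mu]_(x in A) \int[mu]_(y in B) U (x, y) <=
    \int[mu]_(x in A) \int[mu]_(y in B) V (x, y) + delta) ->
  \int[mu]_(y in I) \int[mu]_(x in I) (f x * g y * U (x, y)) <=
  \int[mu]_(y in I) \int[mu]_(x in I) (f x * g y * V (x, y)) + delta.
Proof.
move=> f01 g01 U01 V01 UV.
have mI := measurable_unit_itv R.
have I1 : (mu I <= 1)%E by exact: lebesgue_unit_itv_le1.
have fst01 (k : mT -> R) : mfun01 k -> mfun01 (fun z : mT * mT => k z.1).
  by apply: mfun01_comp; exact: measurable_fst.
have snd01 (k : mT -> R) : mfun01 k -> mfun01 (fun z : mT * mT => k z.2).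
  by apply: mfun01_comp; exact: measurable_snd.
have sw01 (W : mT * mT -> R) : mfun01 W -> mfun01 (fun z : mT * mT => W (z.2, z.1)).
  apply: mfun01_comp; apply/measurable_fun_pairP; split.
    exact: measurable_snd.
  exact: measurable_fst.
pose p (W : mT * mT -> R) x := \int[mu]_(y in I) (g y * W (x, y)).
pose q (A : set mT) (W : mT * mT -> R) y := \int[mu]_(x in A) W (x, y).
have p01 W : mfun01 W -> mfun01 (p W).
  move=> W01; apply: (mfun01_Rintegral mI I1 (F := fun z => g z.2 * W z)).
  by apply: mfun01_mul => //; exact: snd01.
have q01 A W : measurable A -> A `<=` I -> mfun01 W -> mfun01 (q A W).
  move=> mA AI W01; have A1 := lebesgue_unit_itv_le1 mA AI.
  exact: (mfun01_Rintegral (m2 := mu) mA A1 (sw01 _ W01)).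
(* [pE] isolates the factor [f x] and [qE] the factor [g y], which is the shape that [bang_bang1]
   expects. *)
have pE W : mfun01 W ->
    \int[mu]_(y in I) \int[mu]_(x in I) (f x * g y * W (x, y)) =
    \int[mu]_(x in I) (f x * p W x).
  move=> W01; rewrite (mfun01_Rintegral_swap (m1 := mu) (m2 := mu) mI mI I1 I1
    (F := fun z => f z.2 * g z.1 * W (z.2, z.1))); last first.
    by do 2?apply: mfun01_mul; [exact: snd01|exact: fst01|exact: sw01].
  apply: eq_Rintegral => x _; rewrite /p -RintegralZl//=.
    by apply: eq_Rintegral => y _; rewrite mulrA.
  apply: mfun01_integrable => //.
  apply: (mfun01_pair1 (F := fun z => g z.2 * W z)).
  by apply: mfun01_mul => //; exact: snd01.
have qE A W : measurable A -> A `<=` I -> mfun01 W ->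
    \int[mu]_(x in A) p W x = \int[mu]_(y in I) (g y * q A W y).
  move=> mA AI W01; have A1 := lebesgue_unit_itv_le1 mA AI.
  rewrite (mfun01_Rintegral_swap (m1 := mu) (m2 := mu) mA mI A1 I1 (F := fun z => g z.2 * W z)).
    apply: eq_Rintegral => y _; rewrite /q -RintegralZl//=.
    by apply: mfun01_integrable => //; exact: mfun01_pair2.
  by apply: mfun01_mul => //; exact: snd01.
rewrite !pE//.
have [A [mA AI le1]] := bang_bang1 f01 (p01 _ U01) (p01 _ V01).
rewrite !qE// in le1.
have [B [mB BI le2]] := bang_bang1 g01 (q01 _ _ mA AI U01) (q01 _ _ mA AI V01).
have le3 := UV A B mA mB AI BI.
have A1 := lebesgue_unit_itv_le1 mA AI.
have B1 := lebesgue_unit_itv_le1 mB BI.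
(* The hypothesis integrates [y] innermost, whereas [q] integrates [x] first. *)
rewrite !(mfun01_Rintegral_swap (m1 := mu) (m2 := mu) mA mB A1 B1)// in le3.
have combine (a b c d e k D : R) :
    a + b <= c + d -> d + e <= b + k -> k <= e + D -> a <= c + D.
  by clear; lra.
exact: combine le1 le2 le3.
Qed.

End bang_bang.

(** * Counting lemma for labelled densities *)

Section hybrid.
Variable R : realType.
Local Notation mT := (measurableTypeR R).
Local Notation mu := (@lebesgue_measure R).
Local Notation I := (@unit_itv R).
Local Notation bl n := (borel_lebesgue R n).
Local Notation cube n := (@unit_cube R n : set (n.-tuple mT)).

Let mI := measurable_unit_itv R.
Let I1 : (mu I <= 1)%E.
Proof. exact: lebesgue_unit_itv_le1. Qed.

Lemma borel_lebesgue_cube_le1 n : (bl n (cube n) <= 1)%E.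
Proof. by have := borel_lebesgue_cube R n => /= ->. Qed.
Let mcube n := measurable_unit_cube R n.

Lemma mfun01_resample n (i : 'I_n) (F : n.-tuple mT -> R) : mfun01 F ->
  mfun01 (fun z => \int[mu]_(s in I) F (tuple_set z i s)).
Proof.
move=> F01; apply: (mfun01_Rintegral (m2 := mu) mI I1
  (F := fun p => F (tuple_set p.1 i p.2))).
by apply: mfun01_comp F01; exact: measurable_tuple_set.
Qed.

Lemma Rintegral_resample n (i : 'I_n) (F : n.-tuple mT -> R) : mfun01 F ->
  \int[bl n]_(z in cube n) F z =
  \int[bl n]_(z in cube n) \int[mu]_(s in I) F (tuple_set z i s).
Proof.
move=> F01; congr fine; rewrite (integral_resample i)//; last 2 first.
- by apply/measurable_EFinP; case: F01.
- by move=> z; exact: mfun01_ge0.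
apply: eq_integral => z _; rewrite EFin_Rintegral//.
by apply: mfun01_comp F01; exact: measurable_tuple_set_val.
Qed.

Definition indep n (i : 'I_n) (f : n.-tuple mT -> R) :=
  forall z s, f (tuple_set z i s) = f z.

(* [f] carries the dependence on coordinate [i] and [g] that on [j] *)
Definition splits n (i j : 'I_n) (a : n.-tuple mT -> R) :=
  exists f g, [/\ mfun01 f, mfun01 g, indep j f, indep i g &
    forall z, a z = f z * g z].

Lemma splitsM n (i j : 'I_n) a b :
  splits i j a -> splits i j b -> splits i j (fun z => a z * b z).
Proof.
move=> [f [g [f01 g01 fj gi aE]]] [f' [g' [f01' g01' fj' gi' bE]]].
exists (fun z => f z * f' z), (fun z => g z * g' z).
split; [exact: mfun01_mul|exact: mfun01_mul|..].
- by move=> z s; rewrite fj fj'.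
- by move=> z s; rewrite gi gi'.
- by move=> z; rewrite aE bE; ring.
Qed.

Lemma splits_indep n (i j : 'I_n) a : mfun01 a ->
  indep i a \/ indep j a -> splits i j a.
Proof.
have c1 : mfun01 (fun _ : n.-tuple mT => 1 : R).
  by apply: mfun01_cst; rewrite ler01 lexx.
by move=> a01 [ai|aj]; [exists (fun=> 1), a|exists a, (fun=> 1)]; split => // z;
  rewrite ?mul1r ?mulr1.
Qed.

Lemma splits_prod n (i j : 'I_n) (K : eqType) (s : seq K)
    (a : K -> n.-tuple mT -> R) :
  (forall k, k \in s -> splits i j (a k)) ->
  splits i j (fun z => \prod_(k <- s) a k z).
Proof.
elim: s => [|k s IHs] sp.
  under eq_fun do rewrite big_nil.
  apply: splits_indep; last by left.
  by apply: mfun01_cst; rewrite ler01 lexx.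
under eq_fun do rewrite big_cons.
apply: splitsM; first by apply: sp; rewrite mem_head.
by apply: IHs => l ls; apply: sp; rewrite in_cons ls orbT.
Qed.

Definition edge_fun n (U : mT * mT -> R) (e : 'I_n * 'I_n) (z : n.-tuple mT) :=
  U (tnth z e.1, tnth z e.2).

Lemma edge_fun01 n U (e : 'I_n * 'I_n) : mfun01 U -> mfun01 (edge_fun U e).
Proof.
apply: mfun01_comp; apply/measurable_fun_pairP; split; exact: measurable_tnth.
Qed.

Lemma indep_edge_fun n U (e : 'I_n * 'I_n) i :
  i != e.1 -> i != e.2 -> indep i (edge_fun U e).
Proof.
move=> i1 i2 z s; rewrite /edge_fun !tnth_tuple_set.
by rewrite eq_sym (negbTE i1) eq_sym (negbTE i2).
Qed.

Variables (U V : mT * mT -> R) (delta : R).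
Hypotheses (U01 : mfun01 U) (V01 : mfun01 V).
Hypothesis UV : forall A B : set mT,
  measurable A -> measurable B -> A `<=` I -> B `<=` I ->
  \int[mu]_(x in A) \int[mu]_(y in B) U (x, y) <=
  \int[mu]_(x in A) \int[mu]_(y in B) V (x, y) + delta.

(** Redraw coordinates [i] and [j]. With the other coordinates fixed, [a] becomes a function of the
    new [i]-value times a function of the new [j]-value, so [bang_bang2] bounds the inner double
    integral for each [z]. *)
Lemma hybrid_step n (i j : 'I_n) (a : n.-tuple mT -> R) : i != j ->
  splits i j a ->
  \int[bl n]_(z in cube n) (a z * edge_fun U (i, j) z) <=
  \int[bl n]_(z in cube n) (a z * edge_fun V (i, j) z) + delta.
Proof.
move=> ij [f [g [f01 g01 fj gi aE]]].
have C1 := borel_lebesgue_cube_le1 n.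
have a01 : mfun01 a by rewrite (funext aE); exact: mfun01_mul.
have aW01 W : mfun01 W -> mfun01 (fun z => a z * edge_fun W (i, j) z).
  by move=> W01; apply: mfun01_mul => //; exact: edge_fun01.
pose J W z := \int[mu]_(t in I) \int[mu]_(s in I)
  (f (tuple_set z i s) * g (tuple_set z j t) * W (s, t)).
have JE W z : J W z = \int[mu]_(t in I) \int[mu]_(s in I)
    (fun z => a z * edge_fun W (i, j) z) (tuple_set (tuple_set z j t) i s).
  apply: eq_Rintegral => t _; apply: eq_Rintegral => s _.
  (* [g] ignores the outer update at [i]; commuting the two updates lets [f] ignore the one at
     [j]. *)
  rewrite /= aE /edge_fun /= !tnth_tuple_set !eqxx eq_sym (negbTE ij) gi.
  by rewrite tuple_setC 1?eq_sym// fj.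
have intE W : mfun01 W -> \int[bl n]_(z in cube n) (a z * edge_fun W (i, j) z) =
    \int[bl n]_(z in cube n) J W z.
  move=> W01; rewrite (Rintegral_resample i (aW01 W W01)).
  rewrite (Rintegral_resample j (mfun01_resample i (aW01 W W01))).
  by apply: eq_Rintegral => z _; rewrite JE.
have J01 W : mfun01 W -> mfun01 (J W).
  move=> W01; rewrite (funext (JE W)).
  exact: (mfun01_resample j (mfun01_resample i (aW01 W W01))).
have iJ W : mfun01 W -> (bl n).-integrable (cube n) (EFin \o J W).
  by move=> W01; apply: mfun01_integrable; [exact: mcube|exact: C1|exact: J01].
have icst (r : R) : (bl n).-integrable (cube n) (EFin \o cst r).
  apply: measurable_bounded_integrable; [exact: mcube| |exact: measurable_cst|].
    exact: le_lt_trans C1 (ltry _).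
  exact: bounded_cst.
(* The cube has measure 1, so integrating the pointwise bound does not enlarge [delta]. *)
have -> : delta = \int[bl n]_(z in cube n) cst delta z.
  rewrite Rintegral_cst; last exact: mcube.
  by have := borel_lebesgue_cube R n => /= ->; rewrite mulr1.
rewrite !intE// -RintegralD; [|exact: mcube|exact: iJ|exact: icst].
apply: le_Rintegral; [exact: mcube|exact: iJ| |].
  rewrite (_ : EFin \o _ = (EFin \o J V) \+ (EFin \o cst delta))%E//.
  by apply: integrableD; [exact: mcube|exact: iJ|exact: icst].
move=> z _ /=.
apply: (bang_bang2 (f := fun s => f (tuple_set z i s))
  (g := fun t => g (tuple_set z j t))) => //.
- by apply: mfun01_comp f01; exact: measurable_tuple_set_val.
- by apply: mfun01_comp g01; exact: measurable_tuple_set_val.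
Qed.

(** Induction on [E] with [a] general, since the factors already replaced accumulate in [a]. The
    pairwise condition says that [e'] misses an end of [e]; the factor of [e'] is then independent
    of one end of [e], so it splits. *)
Lemma hybrid n (E : seq ('I_n * 'I_n)) (a : n.-tuple mT -> R) :
  uniq E -> (forall e, e \in E -> e.1 != e.2) ->
  (forall e e', e \in E -> e' \in E -> e != e' ->
    (e.1 != e'.1) && (e.1 != e'.2) || (e.2 != e'.1) && (e.2 != e'.2)) ->
  mfun01 a -> (forall e, e \in E -> splits e.1 e.2 a) ->
  \int[bl n]_(z in cube n) (a z * \prod_(e <- E) edge_fun U e z) <=
  \int[bl n]_(z in cube n) (a z * \prod_(e <- E) edge_fun V e z) +
    (size E)%:R * delta.
Proof.
have esp W (e e' : 'I_n * 'I_n) : mfun01 W ->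
    (e.1 != e'.1) && (e.1 != e'.2) || (e.2 != e'.1) && (e.2 != e'.2) ->
    splits e.1 e.2 (edge_fun W e').
  move=> W01 ee'; apply: splits_indep; first exact: edge_fun01.
  by case/orP: ee' => /andP[? ?]; [left|right]; exact: indep_edge_fun.
elim: E a => [|e E IHE] a /=.
  by rewrite mul0r addr0 => _ _ _ _ _; under eq_Rintegral do rewrite big_nil;
    under [leRHS]eq_Rintegral do rewrite big_nil.
move=> /andP[eE uE] loop par a01 asp.
have neq e' : e' \in E -> e != e'.
  by move=> e'E; apply: contraNneq eE => ->.
have inE' e' : e' \in E -> e' \in e :: E by move=> h; rewrite in_cons h orbT.
(* The coefficient of the first edge: [a] together with all later edges, still carrying [U]. *)
pose b z := a z * \prod_(e' <- E) edge_fun U e' z.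
have -> : \int[bl n]_(z in cube n) (a z * \prod_(e' <- e :: E) edge_fun U e' z) =
    \int[bl n]_(z in cube n) (b z * edge_fun U (e.1, e.2) z).
  by apply: eq_Rintegral => z _; rewrite big_cons /b -surjective_pairing; ring.
have bsp : splits e.1 e.2 b.
  apply: splitsM; first by apply: asp; rewrite mem_head.
  apply: splits_prod => e' e'E; apply: esp => //; apply: par; rewrite ?mem_head//.
    exact: inE'.
  exact: neq.
have e12 := loop e (mem_head _ _).
apply: (le_trans (hybrid_step e12 bsp)).
(* The replaced factor [edge_fun V e] joins the coefficient for the remaining edges. The step just
   made costs one [delta], and the induction hypothesis pays for the others. *)
have IH := IHE (fun z => a z * edge_fun V e z) uE
  (fun e' e'E => loop e' (inE' e' e'E))
  (fun e1 e2 h1 h2 => par e1 e2 (inE' e1 h1) (inE' e2 h2)).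
have /IH {}IH : mfun01 (fun z => a z * edge_fun V e z).
  by apply: mfun01_mul => //; exact: edge_fun01.
rewrite -natr1 mulrDl mul1r addrA lerD2r.
have -> : \int[bl n]_(z in cube n) (b z * edge_fun V (e.1, e.2) z) =
    \int[bl n]_(z in cube n)
      (a z * edge_fun V e z * \prod_(e' <- E) edge_fun U e' z).
  by apply: eq_Rintegral => z _; rewrite /b -surjective_pairing; ring.
apply: (le_trans (IH _)).
  move=> e' e'E; apply: splitsM; first exact/asp/inE'.
  apply: esp => //; apply: par; rewrite ?mem_head//; first exact: inE'.
  by rewrite eq_sym; exact: neq.
rewrite lerD2r le_eqVlt; apply/orP; left; apply/eqP.
by apply: eq_Rintegral => z _; rewrite big_cons; ring.
Qed.

End hybrid.

Section counting.
Variables (R : realType) (H : labelled_graph).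
Local Notation mT := (measurableTypeR R).
Local Notation mu := (@lebesgue_measure R).
Local Notation I := (@unit_itv R).
Local Notation bl n := (borel_lebesgue R n).
Local Notation cube n := (@unit_cube R n : set (n.-tuple mT)).
Local Notation unlabelled := {v : vertex H | v != label1 H}.
Local Notation k := #|{: unlabelled}|.

(** Reserving coordinate [ord0] for the label puts all vertices in a single cube, so that edges at
    the label need no separate treatment. *)
Definition vertex_index (v : vertex H) : 'I_k.+1 :=
  if insub v is Some u then lift ord0 (enum_rank (u : unlabelled)) else ord0.

Lemma vertex_index_inj : injective vertex_index.
Proof.
move=> u v; rewrite /vertex_index.
case: insubP => [u' _ <-|/negPn/eqP ->]; case: insubP => [v' _ <-|/negPn/eqP ->] //.
by move/lift_inj/enum_rank_inj ->.
Qed.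

Lemma tnth_vertex_index (y : mT) (x : k.-tuple mT) v :
  tnth (tuple_cons (y, x)) (vertex_index v) = position y x v.
Proof. by rewrite /vertex_index /position; case: insub => [u|]; rewrite ?tnthS ?tnth0. Qed.

Definition is_edge (e : vertex H * vertex H) :=
  adj e.1 e.2 && (enum_rank e.1 < enum_rank e.2)%N.

(** The analogue of [labelled_density] for the uncompleted measure: with [U] Borel the integrand is
    measurable for every [y], and Tonelli applies directly. *)
Definition borel_density (U : mT * mT -> R) (y : mT) : R :=
  \int[bl k]_(x in cube k)
    \prod_(e | is_edge e) U (position y x e.1, position y x e.2).

Let edges := [seq (vertex_index e.1, vertex_index e.2) | e <- enum is_edge].

Let prodE (U : mT * mT -> R) y (x : k.-tuple mT) :
  \prod_(e | is_edge e) U (position y x e.1, position y x e.2) =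
  \prod_(e <- edges) edge_fun U e (tuple_cons (y, x)).
Proof.
rewrite big_map big_enum/=; apply: eq_bigr => e _.
by rewrite /edge_fun/= !tnth_vertex_index.
Qed.

Let prod01 (U : mT * mT -> R) : mfun01 U -> mfun01 (fun p : mT * k.-tuple mT =>
  \prod_(e | is_edge e) U (position p.1 p.2 e.1, position p.1 p.2 e.2)).
Proof.
move=> U01; rewrite (_ : (fun _ => _) = fun p : mT * k.-tuple mT =>
  \prod_(e <- edges) edge_fun U e (tuple_cons p)); last first.
  by apply/funext => -[y x]; rewrite prodE.
apply: mfun01_prod => e; apply: (mfun01_comp (h := @tuple_cons R k)).
  exact: measurable_tuple_cons.
exact: edge_fun01.
Qed.

Lemma borel_density_fun01 (U : mT * mT -> R) y : mfun01 U ->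
  mfun01 (fun x : k.-tuple mT =>
    \prod_(e | is_edge e) U (position y x e.1, position y x e.2)).
Proof. by move=> U01; exact: (mfun01_pair1 (prod01 U01) y). Qed.

Lemma borel_density01 (U : mT * mT -> R) : mfun01 U -> mfun01 (borel_density U).
Proof.
move=> U01; exact: (mfun01_Rintegral (m2 := bl k) (measurable_unit_cube R k)
  (borel_lebesgue_cube_le1 R k) (prod01 U01)).
Qed.

(** Integrating over [A] amounts to weighting the full cube integral by the indicator of [A] at
    coordinate [ord0]; [hybrid] starts from this weight. The bound is one-sided and yields the
    absolute value when applied again with [U] and [V] exchanged. *)
Lemma counting_lemma (U V : mT * mT -> R) (delta : R) : mfun01 U -> mfun01 V ->
  (forall A B : set mT, measurable A -> measurable B -> A `<=` I -> B `<=` I ->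
    \int[mu]_(x in A) \int[mu]_(y in B) U (x, y) <=
    \int[mu]_(x in A) \int[mu]_(y in B) V (x, y) + delta) ->
  forall A : set mT, measurable A -> A `<=` I ->
    \int[mu]_(y in A) borel_density U y <=
    \int[mu]_(y in A) borel_density V y + #|is_edge|%:R * delta.
Proof.
move=> U01 V01 UV A mA AI.
pose a (z : k.+1.-tuple mT) := \1_A (tnth z ord0) : R.
have a01 : mfun01 a.
  by apply: mfun01_comp (mfun01_indic _ mA); exact: measurable_tnth.
have intE W : mfun01 W -> \int[mu]_(y in A) borel_density W y =
    \int[bl k.+1]_(z in cube k.+1) (a z * \prod_(e <- edges) edge_fun W e z).
  move=> W01; have aW01 : mfun01 (fun z => a z * \prod_(e <- edges) edge_fun W e z).
    by apply: mfun01_mul => //; apply: mfun01_prod => e; exact: edge_fun01.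
  have -> : A = I `&` A by rewrite setIC; apply/esym/setIidPl.
  rewrite Rintegral_mkcondr; congr fine; rewrite integral_cube_cons; last 2 first.
  - by apply/measurable_EFinP; case: aW01.
  - by move=> z; exact: (mfun01_ge0 z aW01).
  apply: eq_integral => y _; rewrite patchE /a.
  under [RHS]eq_integral => x _ do rewrite tnth0 indicE -prodE.
  case: (y \in A); last first.
    by rewrite [RHS]integral0_eq// => x _; rewrite mul0r.
  under [RHS]eq_integral => x _ do rewrite mul1r.
  rewrite EFin_Rintegral//; [exact: measurable_unit_cube| |].
    exact: borel_lebesgue_cube_le1.
  exact: borel_density_fun01.
rewrite !intE// (_ : #|is_edge| = size edges); last by rewrite size_map -cardE.
have edgesP e : e \in edges -> exists2 e', is_edge e' & e = (vertex_index e'.1, vertex_index e'.2).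
  by case/mapP => e'; rewrite mem_enum => ? ->; exists e'.
apply: (hybrid U01 V01 UV) => //.
- rewrite map_inj_uniq ?enum_uniq// => -[u v] [u' v'] /= [].
  by move=> /vertex_index_inj -> /vertex_index_inj ->.
- move=> e /edgesP[[u v] /andP[/= uv _] ->] /=; apply: contraTneq uv.
  by move=> /vertex_index_inj ->; rewrite adj_irrefl.
(* Two edges with the same ends are equal or reversed, and the rank order rules out reversal. *)
- move=> e e' /edgesP[[u v] /andP[/= _ uv] ->] /edgesP[[u' v'] /andP[/= _ uv'] ->] /=.
  rewrite !(inj_eq vertex_index_inj); apply: contraNT.
  rewrite negb_or !negb_and !negbK.
  move=> /andP[/orP[]/eqP uE /orP[]/eqP vE]; subst.
  + by rewrite ltnn in uv.
  + by [].
  + by rewrite ltnNge ltnW in uv.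
  + by rewrite ltnn in uv.
(* The weight depends on the label only, and at most one end of an edge is the label. *)
- move=> e /edgesP[[u v] /andP[/= uv _] ->] /=; apply: splits_indep => //.
  have ai i : ord0 != i -> indep i a.
    by move=> i0 z s; rewrite /a tnth_tuple_set (negbTE i0).
  have [u0|u0] := eqVneq ord0 (vertex_index u); last by left; exact: ai.
  right; apply: ai; rewrite u0 (inj_eq vertex_index_inj); apply: contraTneq uv => ->.
  by rewrite adj_irrefl.
Qed.

End counting.

(** * Borel versions of Lebesgue measurable functions *)

Section completion.
Context d (T : measurableType d) (R : realType).
Variable mu : {measure set T -> \bar R}.
Local Notation cT := (caratheodory_type (mu^*)%mu).
Local Notation cmu := (@completed_measure_extension _ _ R mu).

Lemma measurable_completed (A : set T) : measurable A -> measurable (A : set cT).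
Proof. exact: caratheodory_measurable_mu_ext. Qed.

Lemma completedE (A : set T) : measurable A -> cmu A = mu A.
Proof. by move=> mA; rewrite /completed_measure_extension/= measurable_mu_extE. Qed.

Lemma completed_is_complete : measure_is_complete cmu.
Proof. exact: measure_is_complete_caratheodory. Qed.

Lemma negligible_completed (A : set T) : mu.-negligible A -> cmu.-negligible A.
Proof.
move=> [B [mB B0 AB]]; exists B; split => //; first exact: measurable_completed.
by rewrite completedE.
Qed.

(** On an arbitrary set [cmu] is the infimum of the total mass of countable measurable covers. The
    hull is the intersection of covers whose excess is below [1 / (n + 1)]. *)
Lemma measurable_hull (E : set T) : (cmu E < +oo)%E ->
  exists B : set T, [/\ measurable B, E `<=` B & mu B = cmu E].
Proof.
move=> Efin.
have Enum : cmu E \is a fin_num by rewrite ge0_fin_numE// mu_ext_ge0.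
have cov (n : nat) : exists F : (set T)^nat, measurable_cover E F /\
    (\sum_(k <oo) mu (F k) < cmu E + n.+1%:R^-1%:E)%E.
  have n0 : 0 < n.+1%:R^-1 :> R by rewrite invr_gt0.
  by have [_ [F EF <-] lt] := lb_ereal_inf_adherent n0 Enum; exists F.
have {cov} [F /all_and2[FE Flt]] := choice cov.
have mF n : measurable (\bigcup_k F n k).
  by apply: bigcup_measurable => k _; exact: (cover_measurable (FE n)).
pose B := \bigcap_n \bigcup_k F n k.
have mB : measurable B by apply: bigcap_measurable => //; exists 0%N.
have EB : E `<=` B by move=> x Ex n _; exact: (cover_subset (FE n)).
exists B; split => //; apply/eqP; rewrite eq_le; apply/andP; split.
  apply/lee_addgt0Pr => e e0.
  have [n ne] : exists n, n.+1%:R^-1 < e.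
    have := near_infty_natSinv_lt (PosNum e0) => -[n _ /(_ n (leqnn n))] /= h.
    by exists n.
  apply: (@le_trans _ _ (mu (\bigcup_k F n k))).
    by apply: le_measure; rewrite ?inE// => x Bx; exact: (Bx n).
  apply: (@le_trans _ _ (\sum_(k <oo) mu (F n k))%E).
    apply: measure_sigma_subadditive => //.
    exact: (cover_measurable (FE n)).
  by apply: (le_trans (ltW (Flt n))); rewrite leeD2l// lee_fin ltW.
by rewrite -completedE//; exact: le_mu_ext.
Qed.

Lemma negligible_of_completed (E : set T) : cmu E = 0 -> mu.-negligible E.
Proof.
move=> E0; have [|B [mB EB B0]] := @measurable_hull E; first by rewrite E0.
by exists B; rewrite B0 E0.
Qed.

(** Measurability of [E] makes the finite measure [cmu] subtractive, so the excess of the hull has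
    measure zero; a hull of that excess is a null set of the original sigma-algebra. *)
Lemma completed_measurable_hull (E : set T) :
  measurable (E : set cT) -> (cmu E < +oo)%E ->
  exists B : set T, [/\ measurable B, E `<=` B & mu.-negligible (B `\` E)].
Proof.
move=> mE Efin; have [B [mB EB BE]] := measurable_hull Efin.
exists B; split => //; apply: negligible_of_completed.
have mB' := measurable_completed mB.
have Bfin : (cmu B < +oo)%E by rewrite completedE// BE.
transitivity (cmu B - cmu (B `&` E))%E; first exact: (@measureD _ cT R cmu B E mB' mE Bfin).
rewrite (setIidr EB) completedE// BE subee// ge0_fin_numE//.
Qed.

(** On [D], [f] is the supremum over rationals of [a n] times the indicator of [E n]. Replacing each
    [E n] by its hull [B n] makes the supremum measurable and alters it only on the countable union
    of the null sets [B n] minus [E n]. *)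
Lemma borel_version (D : set T) (f : T -> R) :
  measurable D -> (mu D < +oo)%E ->
  measurable_fun (D : set cT) (f : cT -> R) ->
  (forall x, D x -> 0 <= f x <= 1) ->
  exists g : T -> R, mfun01 g /\
    mu.-negligible [set x | D x /\ f x <> g x].
Proof.
move=> mD Dfin mf f01.
(* An enumeration of the rationals truncated to [0, 1]; indices that code no rational get the
   harmless value 0. *)
pose a (n : nat) : R :=
  if choice.unpickle n is Some q then Num.max 0 (Num.min 1 (ratr q)) else 0.
have a01 n : 0 <= a n <= 1.
  rewrite /a; case: choice.unpickle => [q|]; last by rewrite lexx ler01.
  by rewrite le_max lexx/= ge_max ler01/= ge_min lexx.
pose E (n : nat) : set T := D `&` [set x | a n < f x].
have mE n : measurable (E n : set cT).
  have := mf (measurable_completed mD) `]a n, +oo[%classic (measurable_itv _).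
  by congr (measurable _); apply/seteqP; split=> x [Dx] /=; rewrite in_itv/= andbT.
have Efin n : (cmu (E n) < +oo)%E.
  by apply: le_lt_trans Dfin; rewrite -completedE//; apply: le_mu_ext => x [].
have [B /all_and3[mB EB NB]] :=
  choice (fun n => completed_measurable_hull (mE n) (Efin n)).
pose h n x : R := a n * (\1_(B n) : T -> R) x.
have h01 n x : 0 <= h n x <= 1.
  by rewrite /h indicE; case: (x \in B n); rewrite ?mulr1 ?mulr0 ?lexx ?ler01.
have hub x : has_ubound (range (h ^~ x)).
  by exists 1 => _ [n _ <-]; case/andP: (h01 n x).
have sE x : sdrop (h ^~ x) 0 = range (h ^~ x).
  by apply/seteqP; split => _ [n _ <-]; exists n.
exists (fun x => sups (h ^~ x) 0); split; first split.
- apply: measurable_fun_sups => [x _|n]; first exact: hub.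
  by apply: measurable_funM => //; exact: measurable_indic.
- move=> x; rewrite /sups/= sE; apply/andP; split.
    case/andP: (h01 0%N x) => h0 _; apply: (le_trans h0).
    by apply: ub_le_sup; [exact: hub|exists 0%N].
  by apply: ge_sup; [exists (h 0%N x); exists 0%N|move=> _ [n _ <-]; case/andP: (h01 n x)].
- apply: negligibleS (negligible_bigcup NB) => x [Dx fg].
  apply: contrapT => /= nN; apply: fg; rewrite /sups/= sE.
  (* Outside the exceptional set, membership in [B n] and in [E n] coincide. *)
  have BE n : B n x -> a n < f x.
    move=> Bx; apply: contrapT => nE; apply: nN; exists n => //; split => //.
    by move=> [].
  have hE n : h n x = if a n < f x then a n else 0.
    rewrite /h indicE; case: ifPn => [af|af].
      by rewrite mem_set ?mulr1//; apply: EB.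
    by rewrite memNset ?mulr0// => /BE; rewrite (negbTE af).
  have /andP[f0 f1] := f01 x Dx.
  apply/eqP; rewrite eq_le; apply/andP; split.
    rewrite leNgt; apply/negP => sf.
    have s0 : 0 <= sup (range (h ^~ x)).
      case/andP: (h01 0%N x) => h0 _; apply: (le_trans h0).
      by apply: ub_le_sup; [exact: hub|exists 0%N].
    (* A rational strictly between the supremum and [f x] lies in [0, 1], so truncation fixes it and
       its own term exceeds the supremum. *)
    have [q] := rat_in_itvoo sf; rewrite in_itv/= => /andP[sq qf].
    have : h (choice.pickle q) x <= sup (range (h ^~ x)).
      by apply: ub_le_sup; [exact: hub|exists (choice.pickle q)].
    have aq : a (choice.pickle q) = ratr q.
      rewrite /a choice.pickleK min_r; last exact: (le_trans (ltW qf)).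
      by rewrite max_r// (le_trans s0)// ltW.
    by rewrite hE aq qf leNgt sq.
  apply: ge_sup; first by exists (h 0%N x); exists 0%N.
  by move=> _ [n _ <-]; rewrite hE; case: ifPn => // /ltW.
Qed.

(** The identity is measurable from the completed to the original sigma-algebra, and the image of
    [cmu] under it agrees with [mu] on measurable sets. *)
Lemma ge0_integral_completed (D : set T) (g : T -> \bar R) : measurable D ->
  measurable_fun D g -> (forall x, D x -> 0 <= g x)%E ->
  (\int[cmu]_(x in D) g x = \int[mu]_(x in D) g x)%E.
Proof.
move=> mD mg g0.
pose phi : cT -> T := idfun.
have mphi : measurable_fun setT phi.
  by move=> _ A mA; rewrite setTI; exact: measurable_completed.
transitivity (\int[pushforward cmu phi]_(x in D) g x)%E.
  rewrite (ge0_integral_pushforward mphi)// => x.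
  by rewrite inE; exact: g0.
by apply: eq_measure_integral => A mA _; exact: completedE.
Qed.

Lemma integral_completed (D : set T) (g : T -> \bar R) : measurable D ->
  measurable_fun D g ->
  (\int[cmu]_(x in D) g x = \int[mu]_(x in D) g x)%E.
Proof.
move=> mD mg; rewrite [LHS]integralE [RHS]integralE.
rewrite !ge0_integral_completed//.
- exact: measurable_funeneg.
- exact: measurable_funepos.
Qed.

(** Measurability of [f] is inherited from [g] through completeness of [cmu]. *)
Lemma ae_integral_completed (D : set T) (f g : T -> \bar R) : measurable D ->
  measurable_fun D g -> mu.-negligible [set x | D x /\ f x <> g x] ->
  (\int[cmu]_(x in D) f x = \int[mu]_(x in D) g x)%E.
Proof.
move=> mD mg fg; rewrite -integral_completed//.
have mD' := measurable_completed mD.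
have mg' : measurable_fun (D : set cT) (g : cT -> \bar R).
  by move=> _ A mA; apply: measurable_completed; exact: mg.
have gf : ae_eq cmu (D : set cT) (g : cT -> \bar R) f.
  apply: negligibleS (negligible_completed fg) => x /= /not_implyP[Dx gfx].
  by split => // fgx; exact: gfx.
apply: ae_eq_integral => //.
  exact: (ae_measurable_fun completed_is_complete gf).
by apply: filterS gf => x h Dx; rewrite h.
Qed.

End completion.

(** * Borel versions of graphons, cut norms and densities *)

Section graphon_version.
Variable R : realType.
Local Notation mT := (measurableTypeR R).
Local Notation mu := (@lebesgue_measure R).
Local Notation mu2 := ((@lebesgue_measure R) \x (@lebesgue_measure R))%E.
Local Notation I := (@unit_itv R).
Local Notation bl n := (borel_lebesgue R n).
Local Notation cube n := (@unit_cube R n : set (n.-tuple mT)).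

Let mI := measurable_unit_itv R.
Let mII : measurable (I `*` I : set (mT * mT)).
Proof. exact: measurableX. Qed.

Lemma lebesgue2_unit_square_le1 (A B : set mT) : measurable A -> measurable B ->
  A `<=` I -> B `<=` I -> (mu2 (A `*` B) <= 1)%E.
Proof.
move=> mA mB AI BI; rewrite product_measure1E//.
have A1 := lebesgue_unit_itv_le1 mA AI; have B1 := lebesgue_unit_itv_le1 mB BI.
by rewrite -[leRHS]mule1; apply: lee_pmul.
Qed.

Definition is_version (W W' : mT * mT -> R) :=
  mfun01 W' /\ mu2.-negligible [set z | (I `*` I) z /\ W z <> W' z].

Lemma graphon_version (W : R * R -> R) : is_graphon W ->
  exists W', is_version W W'.
Proof.
move=> [mW _ W01]; apply: (@borel_version _ (mT * mT)%type R mu2 (I `*` I)).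
- exact: mII.
- exact: le_lt_trans (lebesgue2_unit_square_le1 mI mI _ _) (ltry _).
- exact: mW.
- by move=> [x y] [/= Ix Iy]; exact: W01.
Qed.

Lemma measurable_lebesgue1 (A : set mT) :
  measurable A -> measurable (A : set (lebesgue1_type R)).
Proof. by move=> mA; exact: sub_caratheodory. Qed.

(** Borel rectangles are among those over which the cut norm takes its supremum, and on them the
    completed integral of [U - V] is the iterated integral of the versions. *)
Lemma cutnorm_version (U U' V V' : mT * mT -> R) (delta : R) :
  is_version U U' -> is_version V V' -> (cutnorm (U \- V)%R <= delta%:E)%E ->
  forall A B : set mT, measurable A -> measurable B -> A `<=` I -> B `<=` I ->
  `| \int[mu]_(x in A) \int[mu]_(y in B) U' (x, y) -
     \int[mu]_(x in A) \int[mu]_(y in B) V' (x, y) | <= delta.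
Proof.
move=> [U01 UU'] [V01 VV'] UV A B mA mB AI BI.
have mAB : measurable (A `*` B : set (mT * mT)) by exact: measurableX.
have AB1 := lebesgue2_unit_square_le1 mA mB AI BI.
have A1 := lebesgue_unit_itv_le1 mA AI; have B1 := lebesgue_unit_itv_le1 mB BI.
rewrite -lee_fin; apply: le_trans UV; apply: ereal_sup_ubound.
exists A, B; split => //; try exact: measurable_lebesgue1.
rewrite (ae_integral_completed (mu := mu2) (g := fun z => (U' z - V' z)%:E) mAB).
- rewrite -abse_EFin; congr abse.
  rewrite !(mfun01_Rintegral_setX mu (m2 := mu) mA mB B1)//.
  have iU := mfun01_integrable mAB AB1 U01.
  have iV := mfun01_integrable mAB AB1 V01.
  rewrite EFinB !fineK; [|exact: (integrable_fin_num mAB iV)|exact: (integrable_fin_num mAB iU)].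
  by rewrite -integralB.
- apply/measurable_EFinP; apply: measurable_funTS; apply: measurable_funB.
    by case: U01.
  by case: V01.
- apply: negligibleS (negligibleU UU' VV') => -[x y] [[/= Ax By] ne].
  have xy : (I `*` I) (x, y) by split; [exact: AI|exact: BI].
  have [UE|] := eqVneq (U (x, y)) (U' (x, y)); last by move/eqP; left.
  by right; split => // VE; apply: ne; rewrite UE VE.
Qed.

Section density_version.
Variable H : labelled_graph.
Local Notation unlabelled := {v : vertex H | v != label1 H}.
Local Notation k := #|{: unlabelled}|.
Variables W W' : mT * mT -> R.
Hypothesis WW' : is_version W W'.

(** After both coordinates are redrawn, the inner double integral is the measure of the part of [N]
    in the unit square. *)
Lemma integral_edge_null (N : set (mT * mT)) n (i j : 'I_n) :
  measurable N -> mu2 N = 0 -> i != j ->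
  (\int[bl n]_(z in cube n) (\1_N (tnth z i, tnth z j) : R)%:E = 0)%E.
Proof.
move=> mN N0 ij.
have mF : measurable_fun setT
    (fun z : n.-tuple mT => (\1_N (tnth z i, tnth z j) : R)%:E).
  apply/measurable_EFinP.
  apply: (measurableT_comp (f := \1_N : mT * mT -> R)).
    exact: measurable_indic.
  by apply/measurable_fun_pairP; split; exact: measurable_tnth.
rewrite (integral_resample2 j i mF)// integral0_eq// => z _.
under eq_integral do under eq_integral do
  rewrite !tnth_tuple_set !eqxx (negbTE ij).
rewrite -(integral_setX mu mu mI mI
  (f := fun z => (\1_N z : R)%:E)); last 2 first.
- by apply/measurable_EFinP; exact: measurable_indic.
- by move=> ?; rewrite lee_fin.
apply/eqP; rewrite eq_le integral_ge0 ?andbT; last by move=> *; rewrite lee_fin.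
rewrite integral_indic// -N0; apply: le_measure; rewrite ?inE//.
exact: measurableI.
Qed.

Lemma labelled_density_version :
  mu.-negligible [set y | I y /\ labelled_density H W y <> borel_density H W' y].
Proof.
have [W01 [N [mN N0 WN]]] := WW'.
(* [F] counts the edges whose ends fall in the null set [N]. Its integral vanishes, so by Tonelli,
   for almost every [y], it is zero at almost every [x]; there every factor of the two products
   agrees. *)
pose F (z : k.+1.-tuple mT) : \bar R := (\sum_(e <- enum (@is_edge H))
  (\1_N (tnth z (vertex_index e.1), tnth z (vertex_index e.2)) : R)%:E)%E.
have F0 z : (0 <= F z)%E by apply: sume_ge0 => e _; rewrite lee_fin.
have mFe (e : vertex H * vertex H) : measurable_fun setT (fun z : k.+1.-tuple mT =>
    (\1_N (tnth z (vertex_index e.1), tnth z (vertex_index e.2)) : R)%:E).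
  apply/measurable_EFinP.
  apply: (measurableT_comp (f := \1_N : mT * mT -> R)).
    exact: measurable_indic.
  by apply/measurable_fun_pairP; split; exact: measurable_tnth.
have mF : measurable_fun setT F by exact: emeasurable_sum.
have mFy y : measurable_fun setT (fun x => F (tuple_cons (y, x))).
  apply: (measurableT_comp mF).
  exact: (measurableT_comp (@measurable_tuple_cons R k) (pair1_measurable y)).
have mc := measurable_unit_cube R k.
have : (\int[bl k.+1]_(z in cube k.+1) F z = 0)%E.
  have mck := measurable_unit_cube R k.+1.
  have mFc e := measurable_funTS (D := cube k.+1) (mFe e).
  have Fe0 (e : vertex H * vertex H) (z : k.+1.-tuple mT) : cube k.+1 z ->
    (0 <= (\1_N (tnth z (vertex_index e.1), tnth z (vertex_index e.2)) : R)%:E)%E.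
    by rewrite lee_fin.
  rewrite (ge0_integral_sum (bl k.+1) mck mFc Fe0).
  rewrite big_seq big1// => e; rewrite mem_enum => /andP[euv _].
  apply: integral_edge_null => //; rewrite (inj_eq (@vertex_index_inj H)).
  by apply: contraTneq euv => ->; rewrite adj_irrefl.
rewrite integral_cube_cons// => I0.
pose G y := (\int[bl k]_(x in cube k) F (tuple_cons (y, x)))%E.
have G0 y : (0 <= G y)%E by exact: integral_ge0.
have mG : measurable_fun I G.
  by apply: measurable_funTS; exact: measurable_integral_cube_cons.
have : ae_eq mu I G (cst 0%E).
  apply/ae_eq_integral_abs => //.
  by under eq_integral do rewrite gee0_abs//.
apply: negligibleS => y /= [Iy ne] Gy; apply: ne.
rewrite /labelled_density /borel_density; congr fine.
have mprod : measurable_fun setT (fun x : k.-tuple mT =>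
    \prod_(e | is_edge e) W' (position y x e.1, position y x e.2)).
  by case: (borel_density_fun01 H y W01).
apply: (ae_integral_completed (mu := bl k)) => //.
  by apply/measurable_EFinP; exact: measurable_funTS.
have : ae_eq (bl k) (cube k) (fun x => F (tuple_cons (y, x))) (cst 0%E).
  apply/ae_eq_integral_abs => //; first exact: measurable_funTS.
  by under eq_integral do rewrite gee0_abs//; exact: Gy.
apply: negligibleS => x /= [cx ne] /(_ cx) Fx; apply: ne; congr EFin.
apply: eq_bigr => e ee.
have pI v : I (position y x v).
  by rewrite /position; case: insub => [u|//]; exact: cx.
apply: contrapT => We.
have Ne : N (position y x e.1, position y x e.2) by apply: WN; split => //; split; exact: pI.
(* One edge landing in [N] already makes the count at least 1. *)
move: Fx; rewrite /F; apply/eqP; rewrite gt_eqF//.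
rewrite (big_rem e) ?mem_enum//=; apply: (@lt_le_trans _ _ 1%E) => //.
rewrite !tnth_vertex_index indicE mem_set// -[leLHS]adde0; apply: leeD => //.
by apply: sume_ge0 => e' _; rewrite lee_fin.
Qed.

End density_version.
End graphon_version.

(** * Threshold colourings *)

Section threshold.
Variable R : realType.
Local Notation mT := (measurableTypeR R).
Local Notation mu := (@lebesgue_measure R).
Local Notation I := (@unit_itv R).

Let mI := measurable_unit_itv R.

Lemma cvge0P (u : nat -> \bar R) : (forall n, (0 <= u n)%E) ->
  u @ \oo --> 0%E <-> forall e : R, 0 < e -> \forall n \near \oo, (u n <= e%:E)%E.
Proof.
move=> u0; split=> [/fine_cvgP[ufin /cvgrPdist_le uc] e e0|h].
  near=> n.
  have un : u n \is a fin_num by near: n.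
  have : `|0 - fine (u n)| <= e by near: n; exact: uc.
  by rewrite sub0r normrN ger0_norm ?fine_ge0// -lee_fin fineK.
have fin : \forall n \near \oo, u n \is a fin_num.
  near=> n; rewrite ge0_fin_numE//; apply: (@le_lt_trans _ _ 1%:E).
    by near: n; exact: h.
  exact: ltry.
apply/fine_cvgP; split => //; apply/cvgrPdist_le => e e0; near=> n.
have un : u n \is a fin_num by near: n.
rewrite sub0r normrN ger0_norm ?fine_ge0// -lee_fin fineK//.
by near: n; exact: h.
Unshelve. all: by end_near. Qed.

(** A Markov-type bound: [d] times the measure of [A] is at most the integral of [g - f], hence at
    most [d * e]. *)
Lemma measure_gap_le (A : set mT) (f g : mT -> R) (d e : R) :
  measurable A -> A `<=` I -> mfun01 f -> mfun01 g -> 0 < d ->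
  (forall x, A x -> f x + d <= g x) ->
  \int[mu]_(x in A) g x <= \int[mu]_(x in A) f x + d * e -> (mu A <= e%:E)%E.
Proof.
move=> mA AI f01 g01 d0 fdg fg; have A1 := lebesgue_unit_itv_le1 mA AI.
have Afin : mu A \is a fin_num.
  by rewrite ge0_fin_numE//; exact: le_lt_trans A1 (ltry _).
rewrite -(fineK Afin) lee_fin -(ler_pM2l d0).
have icst (r : R) : mu.-integrable A (EFin \o cst r).
  apply: measurable_bounded_integrable => //; last exact: bounded_cst.
  exact: le_lt_trans A1 (ltry _).
have fi := mfun01_integrable mA A1 f01; have gi := mfun01_integrable mA A1 g01.
have : \int[mu]_(x in A) (f x + cst d x) <= \int[mu]_(x in A) g x.
  apply: le_Rintegral => //.
  rewrite (_ : EFin \o _ = (EFin \o f) \+ (EFin \o cst d))%E//.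
  by apply: integrableD.
rewrite RintegralD// Rintegral_cst// => /le_trans/(_ fg).
by rewrite lerD2l.
Qed.

(** A disagreement about [alpha] means that [tau 0%N] is within [d] of [alpha], or that [tau n] and
    [tau 0%N] differ by at least [d] in one direction or the other. Each of the three sets gets
    [e / 3]. *)
Lemma threshold_cvg (tau : nat -> mT -> R) (alpha : R) :
  (forall n, mfun01 (tau n)) ->
  (forall e : R, 0 < e -> \forall n \near \oo,
     forall A : set mT, measurable A -> A `<=` I ->
     `|\int[mu]_(x in A) tau n x - \int[mu]_(x in A) tau 0%N x| <= e) ->
  mu (I `&` [set y | tau 0%N y = alpha]) = 0 ->
  (fun n => mu (I `&` [set y | (tau n y < alpha) != (tau 0%N y < alpha)]))
    @ \oo --> 0%E.
Proof.
move=> tau01 tauc null; apply/cvge0P => // e e0.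
pose K (k : nat) : set mT :=
  I `&` [set y | `|tau 0%N y - alpha| <= k.+1%:R^-1].
have mt n : measurable_fun setT (tau n) by case: (tau01 n).
pose P n : set mT := [set y | tau n y < alpha].
have mP n : measurable (P n).
  rewrite (_ : P n = tau n @^-1` `]-oo, alpha[); last first.
    by apply/seteqP; split=> y; rewrite /P/= in_itv.
  by rewrite -[X in measurable X]setTI; exact: mt.
have mK k : measurable (K k).
  apply: measurableI => //; rewrite -[X in measurable X]setTI.
  apply: measurable_fun_le => //; apply: measurableT_comp => //.
  exact: measurable_funB.
have K0 : \bigcap_k K k = I `&` [set y | tau 0%N y = alpha].
  apply/seteqP; split=> [y Ky|y [Iy ty] k _]; last first.
    by split=> //=; rewrite ty subrr normr0.
  split; first by case: (Ky 0%N Logic.I).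
  apply/eqP; rewrite -subr_eq0 -normr_le0; apply/ler_addgt0Pl => r r0.
  have := near_infty_natSinv_lt (PosNum r0) => -[n _ /(_ n (leqnn n))] /= nr.
  by rewrite addr0; have [_ /= h] := Ky n Logic.I; exact: le_trans h (ltW nr).
(* Continuity from above: the bands have finite measure and shrink to the null level set. *)
have Kcvg : mu \o K @ \oo --> 0%E.
  rewrite -null -K0; apply: nonincreasing_cvg_mu => //.
  - apply: le_lt_trans (ltry 1); apply: lebesgue_unit_itv_le1 => //.
    by move=> y [].
  - exact: bigcapT_measurable.
  - move=> m n mn; apply/subsetPset => y [Iy /= h]; split => //=.
    by apply: (le_trans h); rewrite lef_pV2 ?posrE// ler_nat.
have e30 : 0 < e / 3 by lra.
have /cvge0P - /(_ (fun=> measure_ge0 _ _) _ e30) [k _ /(_ k (leqnn k)) /= Kk] := Kcvg.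
(* The width [d] is fixed before [n]; then [n] is taken large enough for accuracy [d * (e / 3)],
   which [measure_gap_le] converts into [e / 3]. *)
pose d : R := k.+1%:R^-1; have d0 : 0 < d by rewrite invr_gt0.
near=> n.
have tn : forall A : set mT, measurable A -> A `<=` I ->
    `|\int[mu]_(x in A) tau n x - \int[mu]_(x in A) tau 0%N x| <= d * (e / 3).
  by near: n; apply: tauc; rewrite mulr_gt0.
pose A1 : set mT := I `&` [set y | tau 0%N y + d <= tau n y].
pose A2 : set mT := I `&` [set y | tau n y + d <= tau 0%N y].
have mA1 : measurable A1.
  apply: measurableI => //; rewrite -[X in measurable X]setTI.
  by apply: measurable_fun_le => //; exact: measurable_funD.
have mA2 : measurable A2.
  apply: measurableI => //; rewrite -[X in measurable X]setTI.
  by apply: measurable_fun_le => //; exact: measurable_funD.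
have A1I : A1 `<=` I by move=> y [].
have A2I : A2 `<=` I by move=> y [].
have m1 : (mu A1 <= (e / 3)%:E)%E.
  apply: (measure_gap_le mA1 A1I (tau01 0%N) (tau01 n) d0); first by move=> x [].
  by have := tn A1 mA1 A1I; rewrite ler_norml => /andP[_]; rewrite lerBlDl.
have m2 : (mu A2 <= (e / 3)%:E)%E.
  apply: (measure_gap_le mA2 A2I (tau01 n) (tau01 0%N) d0); first by move=> x [].
  have := tn A2 mA2 A2I; rewrite distrC ler_norml => /andP[_].
  by rewrite lerBlDl.
apply: (@le_trans _ _ (mu (K k `|` (A1 `|` A2)))).
  apply: le_measure; rewrite ?inE.
  - rewrite (_ : [set y | _] = (P n `\` P 0%N) `|` (P 0%N `\` P n)).
      by apply: measurableI => //; apply: measurableU; exact: measurableD.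
    apply/seteqP; split=> y; rewrite /P/=.
      by case: (_ < _); case: (_ < _) => //= _; [left|right].
    by case: (_ < _); case: (_ < _) => //= -[[]|[]].
  - by apply: measurableU => //; exact: measurableU.
  (* When [tau 0%N y] is further than [d] from [alpha], a value across [alpha] is more than [d] away
     or exactly on the far side, so [y] lies in [A1] or [A2]. *)
  move=> y [Iy /=]; have [yK|] := boolP (`|tau 0%N y - alpha| <= d).
    by left.
  rewrite -ltNge ltr_normr => /orP h ne; right.
  move: ne; case: (ltP (tau n y) alpha) => tny; case: (ltP (tau 0%N y) alpha) => t0y // _.
    right; split => //=; case: h => h; lra.
  left; split => //=; case: h => h; lra.
have -> : e%:E = ((e / 3)%:E + ((e / 3)%:E + (e / 3)%:E))%E.
  by rewrite -!EFinD; congr EFin; lra.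
apply: le_trans (measureU2 _ _ _) _ => //; first exact: measurableU.
apply: leeD => //; apply: le_trans (measureU2 _ _ _) _ => //.
exact: leeD.
Unshelve. all: by end_near. Qed.

(** As an outer measure, [lebesgue1] is monotone and subadditive on arbitrary sets, which spares
    measurability checks on colour classes. *)
Lemma le_lebesgue1 (A B : set R) : A `<=` B -> (lebesgue1 R A <= lebesgue1 R B)%E.
Proof. by move=> AB; exact: (@le_mu_ext _ _ R (wlength idfun) A B AB). Qed.

Lemma lebesgue1U (A B : set R) :
  (lebesgue1 R (A `|` B) <= lebesgue1 R A + lebesgue1 R B)%E.
Proof. exact: (@outer_measureU2 _ _ ((wlength idfun)^*)%mu A B). Qed.

(** Outside the null set [N] the sets [X] and [Y] agree, and the part of [Y] inside [N] is
    measurable by completeness. *)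
Lemma measurable_lebesgue1_version (X : set mT) (Y : set R) : measurable X ->
  mu.-negligible (X `\` Y `|` Y `\` X) -> measurable (Y : set (lebesgue1_type R)).
Proof.
move=> mX [N [mN N0 XYN]].
have -> : Y = (X `\` N) `|` (Y `&` N).
  apply/seteqP; split=> y.
    have [Ny|Ny] := pselect (N y); first by right.
    move=> Yy; left; split => //; apply: contrapT => Xy; apply: Ny.
    by apply: XYN; right.
  move=> [[Xy Ny]|[]//]; apply: contrapT => Yy; apply: Ny.
  by apply: XYN; left.
apply: measurableU; first by apply: measurable_lebesgue1; exact: measurableD.
apply: completed_lebesgue_measure_is_complete; exists N; split => //.
exact: measurable_lebesgue1.
Qed.

End threshold.

(** * Convergence of the threshold-coloured graphons *)

Unset Implicit Arguments.
Set Strict Implicit.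

Theorem theorem4p8 (R : realType) (H : labelled_graph) (alpha : R)
    (alpha_gt0 : 0 < alpha) (alpha_lt1 : alpha < 1)
    (W : nat -> (R * R -> R))
    (WD : forall n : nat, graphon_D H alpha (W n))
    (Wcvg : (fun n : nat => cutnorm (W n \- W 0%N)) @ \oo --> (0%E : \bar R)) :
  let c (n : nat) : R -> S12 := threshold_colour H alpha (W n) in
  (forall n : nat, coloured_graphon (W n, c n)) /\
  (fun n : nat => coloured_dist (W n, c n) (W 0%N, c 0%N)) @ \oo
    --> (0%E : \bar R).
Proof.
move=> c.
pose mT := measurableTypeR R.
pose mu := @lebesgue_measure R; pose I := @unit_itv R.
have mI : measurable (I : set mT) := measurable_unit_itv R.
have [W' WW'] := choice (fun n => graphon_version (proj1 (WD n))).
pose tau n := borel_density H (W' n).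
have tau01 n : mfun01 (tau n) by apply: borel_density01; case: (WW' n).
(* Off this null set the colours can be read from the Borel density [tau n]. *)
pose bad n : set mT := [set y | I y /\ labelled_density H (W n) y <> tau n y].
have badN n : mu.-negligible (bad n) := labelled_density_version H (WW' n).
have cE n y : I y -> ~ bad n y ->
    c n y = if tau n y < alpha then colour1 else colour2.
  move=> Iy nb; rewrite /c /threshold_colour.
  suff -> : labelled_density H (W n) y = tau n y by [].
  by apply: contrapT => ne; apply: nb.
have mlt n : measurable ([set y | tau n y < alpha] : set mT).
  rewrite (_ : [set y | _] = tau n @^-1` `]-oo, alpha[); last first.
    by apply/seteqP; split=> y; rewrite /= in_itv.
  by rewrite -[X in measurable X]setTI; case: (tau01 n) => mt _; exact: mt.
split=> [n|].
  split=> [|B]; first exact: (proj1 (WD n)).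
  pose X : set mT := I `&`
    [set y | B (if tau n y < alpha then colour1 else colour2)].
  apply: (@measurable_lebesgue1_version R X).
    apply: measurableI => //.
    have [B1|B1] := pselect (B colour1); have [B2|B2] := pselect (B colour2).
    - by rewrite (_ : [set y | _] = setT)//; apply/seteqP; split=> // y _ /=; case: ifP.
    - rewrite (_ : [set y | _] = [set y | tau n y < alpha])//.
      by apply/seteqP; split=> y /=; case: ifP.
    - rewrite (_ : [set y | _] = ~` [set y | tau n y < alpha]).
        exact: measurableC.
      by apply/seteqP; split=> y /=; case: ifP.
    - rewrite (_ : [set y | _] = set0)//.
      by apply/seteqP; split=> y //=; case: ifP.
  apply: negligibleS (badN n) => y /=.
  have [//|nb] := pselect (bad n y).
  by rewrite /X /=; case=> -[[Iy]]; rewrite cE// => h []; split.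
have cut0 n : (0 <= cutnorm (W n \- W 0%N)%R)%E.
  apply: le_trans (ereal_sup_ubound _); last first.
    exists set0, set0; split=> //; exact: measurable0.
  exact: abse_ge0.
pose E n : set mT := I `&` [set y | (tau n y < alpha) != (tau 0%N y < alpha)].
have Ecvg : mu \o E @ \oo --> 0%E.
  apply: threshold_cvg => //.
  - move=> e e0; pose m := #|@is_edge H|.
    (* The counting lemma multiplies the cut norm by the number [m] of edges; [m.+1] also covers a
       graph without edges. *)
    have e1 : 0 < e / m.+1%:R by rewrite divr_gt0.
    have /cvge0P - /(_ cut0 _ e1) := Wcvg; apply: filterS => n cutn A mA AI.
    have UV := cutnorm_version (WW' n) (WW' 0%N) cutn.
    have W01 k : mfun01 (W' k) by case: (WW' k).
    have me : m%:R * (e / m.+1%:R) <= e.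
      rewrite mulrCA ger_pMr// ler_pdivrMr// mul1r ler_nat; exact: leqnSn.
    have le1 : \int[mu]_(y in A) tau n y <= \int[mu]_(y in A) tau 0%N y + e.
      refine (le_trans (@counting_lemma R H _ _ (e / m.+1%:R) (W01 n) (W01 0%N) _ A mA AI) _);
        last first.
        by rewrite lerD2l; exact: me.
      move=> A' B' mA' mB' AI' BI'; have := UV A' B' mA' mB' AI' BI'.
      by rewrite ler_norml => /andP[_]; rewrite lerBlDl.
    have le2 : \int[mu]_(y in A) tau 0%N y <= \int[mu]_(y in A) tau n y + e.
      refine (le_trans (@counting_lemma R H _ _ (e / m.+1%:R) (W01 0%N) (W01 n) _ A mA AI) _);
        last first.
        by rewrite lerD2l; exact: me.
      move=> A' B' mA' mB' AI' BI'; have := UV A' B' mA' mB' AI' BI'.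
      by rewrite distrC ler_norml => /andP[_]; rewrite lerBlDl.
    rewrite ler_norml; apply/andP; split; last by rewrite lerBlDl; exact: le1.
    by rewrite lerNl opprB lerBlDl; exact: le2.
  (* Membership of [W 0%N] in the class concerns [labelled_density]; the level set of [tau 0%N]
     exceeds that one only inside a null set. *)
  - have [N [mN N0 bN]] := badN 0%N; apply/eqP; rewrite -measure_le0.
    pose Z : set R := [set y | unit_itv y /\ labelled_density H (W 0%N) y = alpha].
    have sub : I `&` [set y | tau 0%N y = alpha] `<=` Z `|` N.
      move=> y [Iy ty]; have [by0|nb] := pselect (bad 0%N y).
        by right; exact: bN.
      by left; split=> //; rewrite -ty; apply: contrapT => ne; exact: nb.
    have Z0 : lebesgue1 R Z = 0 := proj2 (WD 0%N).
    apply: (le_trans (le_lebesgue1 sub)).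
    have N1 : lebesgue1 R N = 0 := N0.
    by apply: (le_trans (lebesgue1U _ _)); rewrite Z0 N1 add0e.
apply/cvge0P => [n|e e0].
  by apply: adde_ge0; [exact: cut0|apply: sume_ge0 => s _; exact: measure_ge0].
(* For each colour, the symmetric difference of the classes lies in [E n] up to a null set. *)
have dist_le n : (coloured_dist (W n, c n) (W 0%N, c 0%N) <=
    cutnorm (W n \- W 0%N)%R + \sum_(s : S12) mu (E n))%E.
  apply: leeD => //; apply: lee_sum => s _ /=.
  have [N [mN N0 bN]] := negligibleU (badN n) (badN 0%N).
  apply: (@le_trans _ _ (lebesgue1 R (E n `|` N))).
    apply: le_lebesgue1 => y dy.
    have [Ny|Ny] := pselect (N y); [by right|left].
    have nn : ~ bad n y by move=> ?; apply: Ny; apply: bN; left.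
    have n0 : ~ bad 0%N y by move=> ?; apply: Ny; apply: bN; right.
    have Iy : I y by case: dy => -[[]].
    split => //=; apply/negP => /eqP tE; move: dy.
    by rewrite /setY /= cE// cE// tE => -[[[_ ?] []]|[[_ ?] []]]; split.
  apply: (le_trans (lebesgue1U _ _)).
  have N1 : lebesgue1 R N = 0 := N0.
  by rewrite N1 adde0.
pose m := #|S12|.
(* Here [m.+1] counts one term per colour plus the cut norm. *)
have e1 : 0 < e / m.+1%:R by rewrite divr_gt0.
have /cvge0P - /(_ (fun=> measure_ge0 _ _) _ e1) Enear := Ecvg.
have /cvge0P - /(_ cut0 _ e1) cutnear := Wcvg.
near=> n; apply: (le_trans (dist_le n)).
have -> : e%:E = ((e / m.+1%:R)%:E + \sum_(s : S12) (e / m.+1%:R)%:E)%E.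
  have eE : e = (e / m.+1%:R) *+ m.+1 by rewrite -mulr_natr divfK.
  by rewrite sumEFin -EFinD sumr_const -mulrS; congr EFin; exact: eE.
apply: leeD; first by near: n.
by apply: lee_sum => s _; near: n.
Unshelve. all: by end_near. Qed.
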